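(* For every $\varepsilon>0$ there is a real number $C$ such that for all $p/q\in\mathbb{Q}$ with $p/q\ge C$ there exist integers $a,b\ge 1$ with $a/b=p/q$ and $$\frac pq-\Theta_{\mathrm{grp}}(E_{a/b})<\varepsilon.$$
   Context: For integers $a,b\ge 1$, the fraction graph $E_{a/b}$ is the graph with vertex set $\mathbb{Z}/a\mathbb{Z}$ in which two distinct vertices are adjacent if and only if their distance modulo $a$ is strictly less than $b$ (the distance modulo $a$ of $u,v$ is the minimum of $|u'-v'|$ over integer representatives $u',v'$ of $u,v$). It depends on the pair $(a,b)$, not only on the rational number $a/b$. It is a Cayley graph on $\mathbb{Z}/a\mathbb{Z}$. The strong product $G\boxtimes H$ has vertex set $V(G)\times V(H)$, and two distinct vertices $(u,x),(v,y)$ are adjacent iff ($u=v$ or $\{u,v\}\in E(G)$) and ($x=y$ or $\{x,y\}\in E(H)$). $G^{\boxtimes n}$ is the strong product of $n$ copies of $G$; if $G$ is a Cayley graph on a group $\Gamma$, then $G^{\boxtimes n}$ is a Cayley graph on $\Gamma^n$. For a Cayley graph $H$ on a group $\Gamma$, the subgroup independence number $\alpha_{\mathrm{grp}}(H)$ is the size of the largest independent set of $H$ that is a subgroup of $\Gamma$, and the subgroup Shannon capacity is $\Theta_{\mathrm{grp}}(H)=\sup_{n\ge 1}\alpha_{\mathrm{grp}}(H^{\boxtimes n})^{1/n}$. *)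

(* Defs.v *)
From HB Require Import structures.
From mathcomp Require Import all_boot all_order all_algebra all_fingroup.
From mathcomp Require Import all_classical all_reals all_analysis.
Set Implicit Arguments.
Unset Strict Implicit.
Unset Printing Implicit Defensive.
Import Order.TTheory GRing.Theory Num.Theory.

Local Open Scope ring_scope.

(* d = |u' - v'| for some integers u', v' congruent modulo a to u, v. *)
Definition rep_dist (a : nat) (u v : 'I_a) (d : nat) : Prop :=
  exists u' v' : int, [/\ (u' = u%:Z %[mod a%:Z])%Z,
                          (v' = v%:Z %[mod a%:Z])%Z & d = `|u' - v'|%N].

Lemma rep_dist_ex (a : nat) (u v : 'I_a) : exists d, `[< rep_dist u v d >].
Proof.
by exists `|u%:Z - v%:Z|%N; apply/asboolP; exists u%:Z, v%:Z; split.
Qed.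

Definition mod_dist (a : nat) (u v : 'I_a) : nat := ex_minn (rep_dist_ex u v).

(* The vertex type is Z/aZ for every a >= 1: 'I_m.+1 carries the additive group
   of integers modulo m.+1, also for m = 0, whereas 'Z_1 has two elements.
   The value a = 0 is junk. *)
Definition fraction_graph (a b : nat) : rel 'I_a.-1.+1 :=
  fun u v => (u != v) && (mod_dist u v < b)%N.
Arguments fraction_graph a b : clear implicits.

Definition strong_pow (T : finType) (e : rel T) (n : nat) :
    rel {dffun forall _ : 'I_n, T} :=
  fun u v => (u != v) && [forall i, (u i == v i) || e (u i) (v i)].
Arguments strong_pow {T} e n.

Definition cayley (gT : finGroupType) (e : rel gT) : Prop :=
  exists S : {set gT}, forall x y : gT, e x y = ((x^-1 * y)%g \in S).

Definition independent (T : finType) (e : rel T) (A : {set T}) : bool :=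
  [forall x in A, forall y in A, ~~ e x y].

Definition alpha_grp (gT : finGroupType) (e : rel gT) : nat :=
  \max_(K : {group gT} | independent e K) #|K|.

(* The set of roots is bounded above by #|gT|, since
   alpha_grp (strong_pow e n) <= #|gT| ^ n, so that this real supremum is a
   genuine one. The group structure on the n-th power is componentwise. *)
Definition Theta_grp (R : realType) (gT : finGroupType) (e : rel gT) : R :=
  sup [set ((alpha_grp (strong_pow e n))%:R `^ (n%:R)^-1)%R
      | n in [set n : nat | (1 <= n)%N]].

Lemma rep_dist_mulg (m : nat) (w u v : 'I_m.+1) (d : nat) :
  rep_dist u v d -> rep_dist (w * u)%g (w * v)%g d.
Proof.
have valM (x : 'I_m.+1) : ((w * x)%g%:Z = w%:Z + x%:Z %[mod m.+1%:Z])%Z.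
  by rewrite -PoszD -modz_nat modz_mod.
move=> [u' [v' [hu hv ->]]]; exists (w%:Z + u'), (w%:Z + v'); split.
- by rewrite valM -modzDmr hu modzDmr.
- by rewrite valM -modzDmr hv modzDmr.
- by rewrite opprD addrACA subrr add0r.
Qed.

Lemma mod_dist_mulg (m : nat) (w u v : 'I_m.+1) :
  mod_dist (w * u)%g (w * v)%g = mod_dist u v.
Proof.
apply: eq_ex_minn => d; apply/asboolP/asboolP => [/(rep_dist_mulg w^-1%g)|].
  by rewrite !mulKg.
exact: rep_dist_mulg.
Qed.

Lemma cayley_fraction_graph (a b : nat) : cayley (fraction_graph a b).
Proof.
exists [set z | fraction_graph a b 1%g z] => x y; rewrite inE /fraction_graph.
rewrite -(mod_dist_mulg x^-1%g) mulVg; congr (~~ _ && _).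
by rewrite [in RHS]eq_sym -eq_mulVg1.
Qed.

Lemma cayley_strong_pow (gT : finGroupType) (e : rel gT) (n : nat) :
  cayley e -> cayley (strong_pow e n).
Proof.
move=> [S eS]; exists [set z | strong_pow e n 1%g z] => x y.
have dE (g h : gT) : (1%g == (g^-1 * h)%g) = (g == h).
  by rewrite eq_sym -eq_mulVg1.
rewrite inE /strong_pow; congr andb.
  by rewrite [in RHS]eq_sym -eq_mulVg1.
apply: eq_forallb => i; rewrite !eS !ffunE dE.
by rewrite invg1 mul1g.
Qed.

(* Main.v *)
Require Import Defs.
From mathcomp Require Import all_boot all_order all_algebra all_fingroup.
From mathcomp Require Import all_classical all_reals all_analysis.
From mathcomp Require Import ring lra zify.
Import Order.TTheory GRing.Theory Num.Theory.
Local Open Scope ring_scope.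

(** Let r = a/b. A subgroup of (Z/a)^n is independent in the n-th strong power
of E_(a/b) iff each nonzero element has a coordinate at distance at least b
from 0. Subgroups are produced as kernels modulo a of an integer matrix B; such
a kernel has at least |det B| elements as soon as det B divides a
([card_mod_kernel_ge]), which can be arranged because only the ratio a/b is
prescribed. Dividing coordinates by b, independence becomes: if y is a vector
with all |y_j| < 1 and B y lies in r Z^n, then B y = 0. So one wants a matrix
with this separation property whose determinant is close to r^n.

The scalar matrix floor(r) separates, but its determinant floor(r)^n loses a
factor 1 - frac(r)/r for every coordinate. The matrix used here loses such
factors a bounded number of times, whatever n is. After taking n-th roots the
loss is O(1/n), and n is taken of order 1/eps.

Fix K of order 1/eps and write x = N + h/K for the fraction of denominator K
with x + 1/K <= r <= x + 2/K. With n = m + 1, suppose first that K^m divides N.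
Consider the lattice of the vectors
  y_0 = c_0 - (K^(m-1)/N) c_m,   y_1 = c_1 + (h/K) c_0,
  y_i = c_i - c_(i-1)/K          (2 <= i <= m)
for integers c_0, ..., c_m. It contains x Z^n, its covolume is x/N, hence the
index of x Z^n in it is N x^m, and its nonzero vectors have sup norm at least 1.
Indeed suppose all |y_i| < 1. Up to sign and size considerations c_0 is 0 or 1.
If c_0 = 0 then c_1 = 0, c_2 = 0, and so on. If c_0 = 1 then c_1 <= 0 since
y_1 < 1, next c_2 <= 0 since y_2 < 1, and so on up to c_m <= 0, so that
y_0 >= 1: a contradiction. The matrix B of this lattice, the one that satisfies
B y = x c, has on and below the diagonal the entries N/K^(i-j), apart from its
first column, and integers that do not depend on N above the diagonal; row i is
row i - 1 divided by K plus x e_i, for i >= 2.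

For arbitrary N the entries N/K^(i-j) are rounded down to integers
([relation_row]). The rule that gives each row from the previous one then holds
up to a rounding error with bounded entries ([defect]). The gap
r - x >= 1/K absorbs these errors when N is large, except that they could spoil
the sign propagation c_(i-1) <= 0 -> c_i <= 0. To prevent this the first column
is shifted by 2m + 1 at each step, which makes the total error negative when
y_0 is close to 1 ([no_short_relation_ge0]). The determinant stays at least
(N - 1) x^m ([det_relation_mx_ge]). *)

(** * Separation: integer relations satisfied by short vectors *)

(** The weights K^j make the differences s (j + 1) - s j / K telescope. Their sum
turns the bound on the last s into a bound on the border sum, hence on y_0. *)
Lemma telescoped_sum (R : realFieldType) (K x : R) (s y e : nat -> R) (m k : nat) :
  K != 0 -> (k <= m)%N ->
  (forall i, (i < m)%N -> s i.+1 = s i / K + x * y i.+1 + e i) ->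
  K * x * (\sum_(j < k) K ^+ j * y j.+1)
    = K ^+ k * s k - s 0%N - K * \sum_(j < k) K ^+ j * e j.
Proof.
move=> K0; elim: k => [|k IH] km rec.
  by rewrite !big_ord0; ring.
have := IH (ltnW km) rec; rewrite !big_ord_recr /= (rec k km) exprS => E.
by rewrite mulrDr E; field.
Qed.

Lemma norm_weighted_sum_le (R : realFieldType) (K C : R) (f : nat -> R) (m : nat) :
  1 <= K -> (forall j, (j < m)%N -> `|f j| <= C) ->
  `|\sum_(j < m) K ^+ j * f j| <= m%:R * K ^+ m * C.
Proof.
move=> K1 fC; apply: le_trans (ler_norm_sum _ _ _) _.
rewrite -mulrA mulr_natl -[X in _ *+ X]card_ord -sumr_const; apply: ler_sum => j _.
rewrite normrM; apply: ler_pM => //; last by apply: fC; apply: ltn_ord.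
have K0 : 0 <= K by apply: le_trans K1.
rewrite ger0_norm ?exprn_ge0 //; apply: ler_weXn2l => //; exact: ltnW.
Qed.

(** The vector y is short, r c_0 and s (i + 1) = r d_i are the entries of B y, and
the recurrence for s is the one between the rows of B, with errors e_i. The
coefficient rho of y_0 in e_i is the deliberate negative shift: it outweighs the
other rounding errors as soon as y_0 >= 1/2. *)
Lemma no_short_relation_ge0 (R : realFieldType) (m K : nat) (N h x r : R)
    (y e s : nat -> R) (c0 : int) (d : nat -> int) :
  (0 < m)%N -> (0 < K)%N -> 0 <= h -> x = N + h / K%:R -> x + K%:R^-1 <= r ->
  2 * K%:R * (m%:R * K%:R ^+ m) * (3 * m%:R + 1) <= N ->
  (forall j, (j <= m)%N -> `|y j| < 1) ->
  N * y 0%N + \sum_(j < m) K%:R ^+ j * y j.+1 = r * c0%:~R ->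
  s 0%N = - (h * (r * c0%:~R)) ->
  (forall i, (i < m)%N -> s i.+1 = r * (d i)%:~R) ->
  (forall i, (i < m)%N -> s i.+1 = s i / K%:R + x * y i.+1 + e i) ->
  (forall i, (i < m)%N -> exists2 rho : R, - (2 * m%:R + 1) <= rho <= - (2 * m%:R)
     & `|e i - rho * y 0%N| <= \sum_(j < i) `|y j.+1|) ->
  (0 <= c0)%R ->
  c0 = 0 /\ forall i, (i < m)%N -> d i = 0.
Proof.
move=> m0 K0 h0 xE xr; set k := K%:R; set M := m%:R; set W := M * k ^+ m.
move=> big y1 E0 s0 sd rec He c00.
have M1 : 1 <= M by rewrite ler1n.
have k1 : 1 <= k by rewrite ler1n.
have k0 : 0 < k by lra.
have iK : k^-1 * k = 1 by rewrite mulVf ?gt_eqF.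
have iK0 : 0 < k^-1 by rewrite invr_gt0.
have W1 : M <= W by rewrite ler_peMr ?exprn_ege1 //; lra.
have kW : 1 <= k * W by rewrite -[1]mulr1 ler_pM //; lra.
have N1 : 2 * (3 * M + 1) * (k * W) <= N.
  by apply: le_trans big; rewrite le_eqVlt; apply/orP; left; apply/eqP; ring.
have N2 : 8 * (k * W) <= N.
  by apply: le_trans N1; rewrite ler_wpM2r //; lra.
have WkW : W <= k * W by rewrite ler_peMl //; lra.
have N0 : 0 < N by lra.
have hk0 : 0 <= h / k by rewrite mulr_ge0 //; lra.
have x0 : 0 < x by lra.
have Nr : N < r by lra.
have r0 : 0 < r by lra.
have sumy i : (i < m)%N -> \sum_(j < i) `|y j.+1| <= M - 1.
  move=> im; apply: (@le_trans _ _ (\sum_(j < i) 1)).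
    apply: ler_sum => j _; apply/ltW/y1; exact: (leq_trans (ltn_ord j) (ltnW im)).
  rewrite sumr_const card_ord /M; have : (i.+1%:R : R) <= m%:R by rewrite ler_nat.
  by rewrite -natr1; lra.
have ebd i : (i < m)%N -> `|e i| <= (2 * M + 1) * `|y 0%N| + \sum_(j < i) `|y j.+1|.
  move=> im; have [rho /andP[r1 r2] ebd] := He i im.
  rewrite -[e i](subrK (rho * y 0%N)) addrC; apply: le_trans (ler_normD _ _) _.
  apply: lerD => //; rewrite normrM ler_wpM2r //.
  by rewrite ler_norml; apply/andP; split; lra.
have ebd' i : (i < m)%N -> `|e i| <= 3 * M + 1.
  move=> im; apply: le_trans (ebd i im) _; have := sumy i im.
  have : (2 * M + 1) * `|y 0%N| <= (2 * M + 1) * 1.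
    by rewrite ler_wpM2l //; [lra | apply/ltW/y1].
  by lra.
set S := \sum_(j < m) k ^+ j * y j.+1.
have SW : `|S| <= W.
  rewrite -[W]mulr1; apply: (@norm_weighted_sum_le _ _ _ (fun j => y j.+1)) => // j jm.
  exact/ltW/y1.
have sumE : - (W * (3 * M + 1)) <= \sum_(j < m) k ^+ j * e j.
  have := norm_weighted_sum_le R k (3 * M + 1) e m k1 ebd'.
  by rewrite ler_norml -/W => /andP[].
have natM i : (i < m)%N -> i%:R <= M by move=> im; rewrite ler_nat ltnW.
have tel := telescoped_sum R k x s y e m m (lt0r_neq0 k0) (leqnn m) rec.
rewrite -/S in tel E0.
(* From here on only the bounds collected above matter, not the values of the
   parameters. *)
rewrite -/k in xE xr; clear big; clearbody S.
move: (W) W1 kW N1 N2 WkW SW sumE => {}W W1 kW N1 N2 WkW SW sumE.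
clearbody k M.
have y00 : `|y 0%N| < 1 by apply: y1.
have [/andP[SW1 SW2] /andP[y01 y02]] : (- W <= S <= W) /\ (-1 < y 0%N < 1).
  by rewrite -ler_norml -ltr_norml.
have Ny : N * y 0%N < N by rewrite gtr_pMr.
have c0le : c0 = 0 \/ c0 = 1.
  have : (c0%:~R : R) < 2%:~R.
    rewrite -(ltr_pM2l r0) -E0; lra.
  rewrite ltr_int; case: c0 {E0 s0} c00 => [[|[|n]]|n] //; first by left.
  by right.
case: c0le => c0E.
  (* c_0 = 0: then y_0, and one after the other all y_i, are O(1/N), so that the
     errors stay below r - x and |r d_i| < r. *)
  split=> //; rewrite c0E mulr0 in E0; rewrite c0E mulr0 mulr0 oppr0 in s0.
  have y0s : `|y 0%N| <= W / N.
    rewrite ler_pdivlMr // mulrC -[N in N * _]gtr0_norm // -normrM.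
    have -> : N * y 0%N = - S by lra.
    by rewrite normrN.
  have small : (2 * M + 1) * (W / N) <= k^-1 / 2.
    rewrite mulrA ler_pdivrMr // -subr_ge0.
    have -> : k^-1 / 2 * N - (2 * M + 1) * W = k^-1 * (N / 2 - (2 * M + 1) * (k * W)).
      by field; rewrite gt_eqF.
    apply: mulr_ge0; first exact: ltW.
    have : (2 * M + 1) * (k * W) <= (3 * M + 1) * (k * W) by rewrite ler_wpM2r //; lra.
    lra.
  have small2 : M * ((3 * M + 1) / x) <= k^-1 / 2.
    rewrite mulrA ler_pdivrMr // -subr_ge0.
    have -> : k^-1 / 2 * x - M * (3 * M + 1) = k^-1 * (x / 2 - (3 * M + 1) * (k * M)).
      by field; rewrite gt_eqF.
    apply: mulr_ge0; first exact: ltW.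
    have : (3 * M + 1) * (k * M) <= (3 * M + 1) * (k * W).
      by rewrite ler_wpM2l ?ler_wpM2l //; lra.
    lra.
  have all0 : forall i, (i <= m)%N -> s i = 0 /\
      forall j, (j < i)%N -> d j = 0 /\ `|y j.+1| <= (3 * M + 1) / x.
    elim=> [|i IH] im; first by split.
    have [si dj] := IH (ltnW im).
    have R1 := rec i im; rewrite si mul0r add0r in R1.
    have eb : `|e i| <= k^-1.
      apply: le_trans (ebd i im) _.
      have : \sum_(j < i) `|y j.+1| <= M * ((3 * M + 1) / x).
        apply: (@le_trans _ _ (\sum_(j < i) (3 * M + 1) / x)).
          by apply: ler_sum => j _; case: (dj j (ltn_ord j)).
        rewrite sumr_const card_ord -[X in X <= _]mulr_natl.
        apply: ler_wpM2r; last exact: natM.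
        by rewrite divr_ge0 //; lra.
      have : (2 * M + 1) * `|y 0%N| <= (2 * M + 1) * (W / N) by rewrite ler_wpM2l //; lra.
      lra.
    have xy : `|x * y i.+1| < x by rewrite normrM gtr0_norm // gtr_pMr // y1.
    have di : d i = 0.
      have : `|r * (d i)%:~R| < r.
        rewrite -sd // R1; apply: le_lt_trans (ler_normD _ _) _; lra.
      rewrite normrM gtr0_norm // gtr_pMr // -intr_norm -[1]/(1%:~R) ltr_int.
      by case: (d i) => [[|n]|[|n]].
    have si1 : s i.+1 = 0 by rewrite sd // di mulr0.
    split=> // j; rewrite ltnS leq_eqVlt => /orP[/eqP->|/dj//]; split => //.
    rewrite ler_pdivlMr // mulrC -[x in x * _]gtr0_norm // -normrM.
    have -> : x * y i.+1 = - e i by lra.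
    by rewrite normrN ebd'.
  by move=> i im; case: (all0 m (leqnn m)) => _ /(_ i im)[].
(* c_0 = 1: the errors are nonpositive, so the s i are nonpositive by induction,
   which forces y_0 >= 1. *)
exfalso; rewrite c0E mulr1 in E0; rewrite c0E mulr1 in s0.
have y0h : 2^-1 <= y 0%N.
  rewrite -(ler_pM2l N0); have : N * y 0%N = r - S by lra.
  lra.
have e0 i : (i < m)%N -> e i <= 0.
  move=> im; have [rho /andP[r1 r2]] := He i im.
  rewrite ler_norml => /andP[_ b]; have := sumy i im.
  have : rho * y 0%N <= - (2 * M) * y 0%N by rewrite ler_wpM2r //; lra.
  have : M * 2^-1 <= M * y 0%N by rewrite ler_wpM2l //; lra.
  lra.
have sle : forall i, (i <= m)%N -> s i <= 0.
  elim=> [_|i IH im]; first by rewrite s0 oppr_le0 mulr_ge0 //; lra.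
  have si := IH (ltnW im).
  have : s i.+1 < r.
    have : s i / k <= 0 by rewrite mulr_le0_ge0 // ltW.
    have : x * y i.+1 < x by rewrite gtr_pMr //; move: (y1 _ im); rewrite ltr_norml => /andP[].
    have := e0 i im; rewrite (rec i im) -/k; lra.
  rewrite sd // => lt1; rewrite pmulr_rle0 //.
  have : ((d i)%:~R : R) < 1%:~R by rewrite -(ltr_pM2l r0) mulr1.
  by rewrite ltr_int -[0]/(0%:~R) ler_int; case: (d i) => [[|n]|n].
have sm : k ^+ m * s m <= 0 by rewrite mulr_ge0_le0 ?exprn_ge0 ?sle // ltW.
rewrite s0 in tel.
have SU : k * (x * S) <= h * r + k * (W * (3 * M + 1)).
  have : k * - (W * (3 * M + 1)) <= k * \sum_(j < m) k ^+ j * e j by rewrite ler_wpM2l // ltW.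
  lra.
have Sr : S <= r - N.
  rewrite -(ler_pM2l x0) -(ler_pM2l k0); apply: le_trans SU _.
  have hE : h = k * (x - N) by rewrite xE; field; rewrite gt_eqF.
  rewrite hE.
  have : k * (W * (3 * M + 1)) <= N by rewrite mulrA; lra.
  have : 1 <= k * (r - x) by rewrite -(ler_pM2l iK0) mulrA iK mul1r mulr1; lra.
  have := N0; have := k0; nra.
have : N <= N * y 0%N by lra.
lra.
Qed.

(** * Determinant of a bordered triangular matrix *)

Lemma forward_substitution_bound (R : realFieldType) (m : nat) (P : 'M[R]_m)
    (t g : 'cV[R]_m) (x D : R) :
  0 < x -> 0 <= D -> D + m%:R <= x -> P *m t = g ->
  (forall i, P i i = x) -> (forall i j : 'I_m, (i < j)%N -> P i j = 0) ->
  (forall i j : 'I_m, (j < i)%N -> `|P i j| <= 1) -> (forall i, `|g i 0| <= D) ->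
  forall i, `|t i 0| <= (D + m%:R) / x.
Proof.
move=> x0 D0 Dx Pt Pd Pu Pl gD.
have D1 : (D + m%:R) / x <= 1 by rewrite ler_pdivrMr // mul1r.
suff H : forall (k : nat) (i : 'I_m), (i < k)%N -> `|t i 0| <= (D + m%:R) / x.
  by move=> i; apply: (H i.+1).
elim=> [//|k IH] i ik.
have := congr1 (fun M : 'cV_m => M i 0) Pt; rewrite !mxE (bigD1 i) //= Pd => E.
rewrite ler_pdivlMr // mulrC -[x in x * _]gtr0_norm // -normrM.
have -> : x * t i 0 = g i 0 - \sum_(j < m | j != i) P i j * t j 0 by rewrite -E addrK.
apply: le_trans (ler_normB _ _) _; apply: lerD => //.
apply: le_trans (ler_norm_sum _ _ _) _.
apply: (@le_trans _ _ (\sum_(j < m) 1)); last by rewrite sumr_const card_ord.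
rewrite big_mkcond /=; apply: ler_sum => j _; case: eqP => //= /eqP ji.
rewrite normrM; have [ij|ji'] := ltnP i j; first by rewrite Pu // normr0 mul0r.
have ltji : (j < i)%N by rewrite ltn_neqAle ji' ji.
rewrite -[1]mulr1; apply: ler_pM => //; first exact: Pl.
by apply: le_trans D1; apply: IH; apply: leq_trans ltji _.
Qed.

Lemma det_bordered (F : fieldType) (m : nat) (a : 'M[F]_1) (w : 'rV[F]_m)
    (g : 'cV[F]_m) (P : 'M[F]_m) : P \in unitmx ->
  \det (block_mx a w g P) = (a 0 0 - (w *m (invmx P *m g)) 0 0) * \det P.
Proof.
move=> Pu.
have E : block_mx a w g P *m block_mx 1%:M 0 (- (invmx P *m g)) 1%:M
    = block_mx (a - w *m (invmx P *m g)) w 0 P.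
  rewrite mulmx_block !mulmx1 !mulmx0 !add0r !mulmxN.
  by rewrite mulKVmx // subrr.
have := congr1 determinant E.
by rewrite det_mulmx det_lblock !det1 !mulr1 det_ublock det_mx11 !mxE.
Qed.

(** By [det_bordered] the border only replaces N by N - w t, where P t = g. Solving
this triangular system gives t of size O(1/x), so that w t <= 1 for large x. *)
Lemma det_bordered_lower_bound (R : realFieldType) (m : nat) (N x D W : R)
    (w : 'rV[R]_m) (g : 'cV[R]_m) (P : 'M[R]_m) :
  0 < x -> 0 <= D -> D + m%:R <= x -> W * (D + m%:R) <= x ->
  (forall i, P i i = x) -> (forall i j : 'I_m, (i < j)%N -> P i j = 0) ->
  (forall i j : 'I_m, (j < i)%N -> `|P i j| <= 1) -> (forall i, `|g i 0| <= D) ->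
  \sum_j `|w 0 j| <= W ->
  (N - 1) * x ^+ m <= \det (block_mx N%:M w g P).
Proof.
move=> x0 D0 Dx WD Pd Pu Pl gD wW.
have detP : \det P = x ^+ m.
  rewrite det_trig; last by apply/is_trig_mxP.
  by rewrite (eq_bigr (fun=> x)) // prodr_const card_ord.
have Punit : P \in unitmx by rewrite unitmxE detP unitfE expf_neq0 // gt_eqF.
rewrite det_bordered // detP; apply: ler_wpM2r; first by rewrite exprn_ge0 // ltW.
set t := invmx P *m g.
have tb : forall i, `|t i 0| <= (D + m%:R) / x.
  apply: forward_substitution_bound Pd Pu Pl gD => //.
  by rewrite /t mulKVmx.
rewrite [N%:M 0 0]mxE eqxx mulr1n lerD2l lerN2 [X in X <= _]mxE.
apply: le_trans (ler_norm _) _; apply: le_trans (ler_norm_sum _ _ _) _.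
apply: (@le_trans _ _ (\sum_j `|w 0 j| * ((D + m%:R) / x))).
  by apply: ler_sum => j _; rewrite normrM ler_wpM2l.
rewrite -mulr_suml; apply: (@le_trans _ _ (W * ((D + m%:R) / x))).
  by rewrite ler_wpM2r // divr_ge0 ?addr_ge0 // ltW.
by rewrite mulrA ler_pdivrMr // mul1r.
Qed.

(** * The relation matrix *)

(** Opposites of the entries of the first column, obtained by rounding h N / K^i.
The term 2m + 1 is the shift that makes the total error negative: half of
it still exceeds the sum of the at most m - 1 errors, of size at most 1, in the
other columns. *)
Fixpoint border (m K N h i : nat) : nat :=
  if i is i'.+1 then (border m K N h i' %/ K + (2 * m + 1))%N else (h * N)%N.

(** Row 0 here is -h times the first row of the matrix, not the first row itself:
with this convention the recurrence between consecutive rows also holds at the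
first step, see [relation_row0] and [relation_row_recurrence]. *)
Definition relation_row (m K N h i j : nat) : int :=
  if j is j'.+1 then
    if (j <= i)%N then (N %/ K ^ (i - j))%N%:Z else - (h * K ^ (j' - i))%N%:Z
  else - (border m K N h i)%:Z.

Definition first_row (K N j : nat) : int := if j is j'.+1 then (K ^ j')%N%:Z else N%:Z.

Definition relation_mx (m K N h : nat) : 'M[int]_(1 + m) :=
  \matrix_(i, j) if i == 0%N :> nat then first_row K N j else relation_row m K N h i j.

(** What prevents row i + 1 from being exactly row i divided by K plus x e_(i+1),
where x = N + h/K. It vanishes beyond column i: above the diagonal the entries
are exact, and on it N + h/K = x. *)
Definition defect (R : realFieldType) (m K N h i j : nat) : R :=
  (relation_row m K N h i.+1 j)%:~R - (relation_row m K N h i j)%:~R / K%:R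
    - (N%:R + h%:R / K%:R) *+ (j == i.+1).

Lemma relation_row0 (m K N h j : nat) :
  relation_row m K N h 0 j = - (h%:Z * first_row K N j).
Proof. by case: j => [|j] //=; rewrite subn0 PoszM. Qed.

Lemma divn_defect (R : realFieldType) (u K : nat) : (0 < K)%N ->
  -1 <= ((u %/ K)%N%:R - u%:R / K%:R : R) <= 0.
Proof.
move=> K0; have k0 : 0 < K%:R :> R by rewrite ltr0n.
have uE : u%:R = (u %/ K)%N%:R * K%:R + (u %% K)%N%:R :> R.
  by rewrite {1}(divn_eq u K) natrD natrM.
have r0 : 0 <= (u %% K)%N%:R / K%:R :> R by rewrite divr_ge0.
have r1 : (u %% K)%N%:R / K%:R <= 1 :> R.
  by rewrite ler_pdivrMr // mul1r ler_nat ltnW // ltn_pmod.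
have -> : (u %/ K)%N%:R - u%:R / K%:R = - ((u %% K)%N%:R / K%:R) :> R.
  by rewrite uE; field; rewrite gt_eqF.
by rewrite lerN2 r1 oppr_le0.
Qed.

Lemma defect_border (R : realFieldType) (m K N h i : nat) : (0 < K)%N ->
  - (2 * m%:R + 1) <= defect R m K N h i 0 <= - (2 * m%:R).
Proof.
move=> K0; rewrite /defect mulr0n subr0 /= !rmorphN /= -!pmulrn !natrD.
have /andP[a b] := divn_defect R (border m K N h i) K K0.
by apply/andP; split; lra.
Qed.

Lemma defect_gt (R : realFieldType) (m K N h i j : nat) : (0 < K)%N ->
  (i < j)%N -> defect R m K N h i j = 0.
Proof.
move=> K0; case: j => // j; rewrite ltnS => ij.
have k0 : K%:R != 0 :> R by rewrite pnatr_eq0 -lt0n.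
rewrite /defect /= ltnS eqSS; have [ji|ji] := leqP j i.
  have -> : j = i by apply/eqP; rewrite eqn_leq ji ij.
  rewrite ltnn eqxx !subnn expn0 divn1 muln1 mulr1n rmorphN /= -!pmulrn.
  by field.
rewrite ltnNge ij /= gtn_eqF // mulr0n subr0 !rmorphN /= -!pmulrn.
have -> : (j - i = (j - i.+1).+1)%N by lia.
by rewrite expnS !natrM; field.
Qed.

Lemma defect_le (R : realFieldType) (m K N h i j : nat) : (0 < K)%N ->
  (j < i)%N -> `|defect R m K N h i j.+1| <= 1.
Proof.
move=> K0 ji; rewrite /defect /= ji (leq_trans ji) // eqSS ltn_eqF // mulr0n subr0 -!pmulrn.
rewrite subSS; have -> : (i - j = (i - j.+1).+1)%N by lia.
rewrite expnSr divnMA ler_norml.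
have /andP[a b] := divn_defect R (N %/ K ^ (i - j.+1)) K K0.
by apply/andP; split; lra.
Qed.

Lemma relation_row_recurrence (R : realFieldType) (m K N h i : nat) (y : nat -> R) :
  (0 < K)%N -> (i < m)%N ->
  \sum_(j < m.+1) (relation_row m K N h i.+1 j)%:~R * y j
    = (\sum_(j < m.+1) (relation_row m K N h i j)%:~R * y j) / K%:R
      + (N%:R + h%:R / K%:R) * y i.+1
      + \sum_(j < i.+1) defect R m K N h i j * y j.
Proof.
move=> K0 im.
have -> : \sum_(j < i.+1) defect R m K N h i j * y j = \sum_(j < m.+1) defect R m K N h i j * y j.
  rewrite (big_ord_widen m.+1 (fun j => defect R m K N h i j * y j)) 1?ltnW //.
  rewrite big_mkcond; apply: eq_bigr => j _; case: ltnP => // ij.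
  by rewrite defect_gt // mul0r.
have -> : (N%:R + h%:R / K%:R) * y i.+1
    = \sum_(j < m.+1) ((N%:R + h%:R / K%:R) *+ (j == i.+1 :> nat)) * y j.
  rewrite (bigD1 (Ordinal (im : (i.+1 < m.+1)%N))) //= eqxx mulr1n big1 ?addr0 // => j ji.
  rewrite [_ == _]negbTE ?mulr0n ?mul0r //.
rewrite mulr_suml -!big_split /=; apply: eq_bigr => j _.
by rewrite /defect; ring.
Qed.

(** The unitriangular matrix that subtracts from each row the multiple of the
previous one in the recurrence. What remains is x on the diagonal, the defects
below it, and the first row as a border. *)
Definition reduction_mx (R : realFieldType) (m K h : nat) : 'M[R]_(1 + m) :=
  \matrix_(i, j) if i == j then 1 else
    if (i == j.+1 :> nat) then (if j == 0%N :> nat then h%:R / K%:R else - K%:R^-1) else 0.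

Lemma reduction_mx_row (R : realFieldType) (m K h : nat) (i : 'I_(1 + m)) (f : nat -> R) :
  \sum_k reduction_mx R m K h i k * f k
    = f i + (if i : nat is i'.+1 then (if i' == 0%N then h%:R / K%:R else - K%:R^-1) * f i' else 0).
Proof.
rewrite (bigD1 i) //= mxE eqxx mul1r; congr (_ + _).
case: i => -[|i] im /=.
  by apply: big1 => k ki; rewrite mxE eq_sym (negPf ki) /= mul0r.
rewrite (bigD1 (Ordinal (ltnW im))) /=; last by apply/eqP => -[/eqP]; rewrite ltn_eqF.
rewrite mxE /= eqxx -val_eqE /= gtn_eqF // big1 ?addr0 // => k /andP[ki ki'].
rewrite mxE eq_sym (negPf ki) /= eqSS ifF ?mul0r //.
by apply/negbTE; rewrite eq_sym; apply: contra ki' => /eqP E; apply/eqP/val_inj.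
Qed.

Lemma reduction_mxE (R : realFieldType) (m K N h : nat) : (0 < K)%N ->
  reduction_mx R m K h *m map_mx intr (relation_mx m K N h) =
  block_mx N%:R%:M (\row_(j < m) K%:R ^+ j) (\col_i defect R m K N h i 0)
   (\matrix_(i, j) (defect R m K N h i j.+1 + (N%:R + h%:R / K%:R) *+ (i == j))).
Proof.
move=> K0; set B := map_mx _ _.
pose f (j k : nat) : R := (if k == 0%N then first_row K N j else relation_row m K N h k j)%:~R.
have LE i j : (reduction_mx R m K h *m B) i j =
    f j i + (if i : nat is i'.+1 then (if i' == 0%N then h%:R / K%:R else - K%:R^-1) * f j i' else 0).
  by rewrite -reduction_mx_row mxE; apply: eq_bigr => k _; rewrite !mxE.
have LE1 (i : 'I_m) j : (reduction_mx R m K h *m B) (rshift 1 i) j =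
    defect R m K N h i j + (N%:R + h%:R / K%:R) *+ (j == i.+1 :> nat).
  rewrite LE /= add0n /defect /f /=.
  case: eqP => [->|_]; last by rewrite subrK mulNr mulrC.
  by rewrite subrK relation_row0 rmorphN rmorphM /= -!pmulrn; field; rewrite pnatr_eq0 -lt0n.
rewrite -[LHS]submxK; congr block_mx; apply/matrixP => i j.
- rewrite 2!mxE LE /f /= !ord1 /= addr0 //.
  by rewrite [RHS]mxE.
- by rewrite 3!mxE LE /f /= [i]ord1 /= addr0 -pmulrn -natrX.
- by rewrite 2!mxE LE1 mxE /= [j]ord1 /= mulr0n addr0.
- by rewrite 2!mxE LE1 mxE /= eqSS eq_sym.
Qed.

Lemma det_relation_mx_ge (R : realFieldType) (m K N h : nat) : (0 < K)%N ->
  ((m * K ^ m + 1) * (3 * m + 1) <= N)%N ->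
  (N%:R - 1) * (N%:R + h%:R / K%:R) ^+ m <= (\det (relation_mx m K N h))%:~R :> R.
Proof.
move=> K0 Nbig.
have k1 : 1 <= K%:R :> R by rewrite ler1n.
have -> : (\det (relation_mx m K N h))%:~R
    = \det (reduction_mx R m K h *m map_mx intr (relation_mx m K N h)).
  rewrite det_mulmx det_map_mx det_trig; last first.
    apply/is_trig_mxP => i j ij; rewrite mxE -val_eqE ltn_eqF // ltn_eqF //.
    exact: leq_trans ij _.
  by rewrite big1 ?mul1r // => i _; rewrite mxE eqxx.
rewrite reduction_mxE //.
have Nbig' : (m%:R * K%:R ^+ m + 1) * (3 * m%:R + 1) <= N%:R :> R.
  by move: Nbig; rewrite -(ler_nat R) !(natrM, natrD, natrX).
have W0 : 0 <= m%:R * K%:R ^+ m * (3 * m%:R + 1) :> R.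
  by rewrite !mulr_ge0 ?exprn_ge0 ?addr_ge0 ?mulr_ge0.
have f0 : 0 <= h%:R / K%:R :> R by rewrite divr_ge0.
have m0 : 0 <= m%:R :> R by [].
apply: (@det_bordered_lower_bound _ _ _ _ (2 * m%:R + 1) (m%:R * K%:R ^+ m)).
- lra.
- lra.
- lra.
- lra.
- by move=> i; rewrite mxE eqxx defect_gt // add0r.
- move=> i j ij; rewrite mxE -val_eqE ltn_eqF // addr0 defect_gt //.
  exact: leq_trans ij _.
- by move=> i j ij; rewrite mxE -val_eqE gtn_eqF // addr0 defect_le.
- move=> i; rewrite mxE ler_norml; have /andP[a b] := defect_border R m K N h i K0.
  by apply/andP; split; lra.
- apply: (@le_trans _ _ (\sum_(j < m) K%:R ^+ m)).
    apply: ler_sum => j _; rewrite mxE ger0_norm ?exprn_ge0 //.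
    by apply: ler_weXn2l => //; rewrite ltnW.
  by rewrite sumr_const card_ord mulr_natl.
Qed.

(** * Kernels of integer matrices modulo an integer *)

Lemma dvdz_mulmx_col (n : nat) (a : int) (M : 'M[int]_n) (v : 'cV[int]_n) :
  (forall i, (a %| v i 0%R)%Z) -> forall i, (a %| (M *m v)%R i 0%R)%Z.
Proof.
by move=> av i; rewrite mxE; apply: rpred_sum => j _; apply/dvdz_mull/av.
Qed.

Lemma absz_det_unitmx (n : nat) (M : 'M[int]_n) : M \in unitmx -> `|\det M|%N = 1%N.
Proof. by rewrite unitmxE => /orP[]/eqP->. Qed.

Definition mod_kernel (n k : nat) (B : 'M[int]_n) : {set {dffun forall _ : 'I_n, 'I_k.+1}} :=
  [set u : {dffun forall _ : 'I_n, 'I_k.+1} | [forall i, (k.+1%:Z %| \sum_j B i j * (u j : nat)%:Z)%Z]].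

(** In Smith normal form B is diagonal, with entries d_i that divide det B, hence
divide the modulus a. The vectors with i-th coordinate a/d_i times t_i, where
0 <= t_i < |d_i|, are then distinct elements of the kernel, and there are
|det B| of them. *)
Lemma card_mod_kernel_ge (n k : nat) (B : 'M[int]_n) :
  \det B != 0 -> (`|\det B| %| k.+1)%N -> (`|\det B| <= #|mod_kernel n k B|)%N.
Proof.
move=> B0 Ba; set a : int := k.+1%:Z.
have [L Lu [Q Qu [d _ BE]]] := int_Smith_normal_form B.
pose E : 'M[int]_n := \matrix_(i, j) (d`_i *+ (i == j :> nat)).
have detE : \det E = \prod_(i < n) d`_i.
  rewrite det_trig; last by apply/is_trig_mxP => i j ij; rewrite mxE ltn_eqF.
  by apply: eq_bigr => i _; rewrite mxE eqxx.
pose dd (i : 'I_n) : int := d`_i.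
have detB : `|\det B|%N = (\prod_(i < n) `|dd i|)%N.
  rewrite BE !det_mulmx !abszM (absz_det_unitmx _ _ Lu) (absz_det_unitmx _ _ Qu) mul1n muln1 -/E detE.
  by rewrite (big_morph absz abszM (erefl _)).
have dvd_a (i : 'I_n) : (dd i %| a)%Z.
  by rewrite /dvdz /=; apply: dvdn_trans Ba; rewrite detB (bigD1 i) //= dvdn_mulr.
have a0 : a != 0 by [].
pose T := {dffun forall i : 'I_n, 'I_(`|dd i|)}.
pose w (t : T) : 'cV[int]_n := \col_i ((a %/ dd i)%Z * (t i : nat)%:Z).
pose v (t : T) := invmx Q *m w t.
pose u (t : T) : {dffun forall _ : 'I_n, 'I_k.+1} := [ffun i => inord `|((v t) i 0%R %% a)%Z|%N].
have uE t i : (a %| (u t i : nat)%:Z - v t i 0%R)%Z.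
  rewrite -eqz_mod_dvd ffunE inordK; last first.
    by rewrite -ltz_nat abszE ger0_norm ?modz_ge0 // ltz_pmod.
  by rewrite abszE ger0_norm ?modz_ge0 // modz_mod.
have uK t : u t \in mod_kernel n k B.
  rewrite inE; apply/forallP => i.
  have -> : \sum_j B i j * (u t j : nat)%:Z
     = (B *m \col_j ((u t j : nat)%:Z - v t j 0)) i 0 + (B *m v t) i 0.
    rewrite !mxE -big_split /=; apply: eq_bigr => j _.
    by rewrite !mxE -mulrDr subrK.
  apply: rpredD; first by apply: dvdz_mulmx_col => j; rewrite mxE.
  rewrite BE -/E /v mulmxA mulmxK // -mulmxA.
  apply: dvdz_mulmx_col => j; rewrite mxE (bigD1 j) //= big1 ?addr0; last first.
    by move=> l lj; rewrite !mxE eq_sym val_eqE (negPf lj) mul0r.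
  by rewrite !mxE eqxx mulr1n mulrA mulrC; apply/dvdz_mull; rewrite mulrC divzK.
have uinj : injective u.
  move=> t t' utt'; apply/ffunP => i; apply/val_inj => /=.
  have vv : forall j, (a %| (v t - v t')%R j 0%R)%Z.
    move=> j; have subE (A A' : 'cV[int]_n) : (A - A') j 0 = A j 0 - A' j 0 by rewrite !mxE.
    have -> : (v t - v t') j 0 = ((u t' j : nat)%:Z - v t' j 0) - ((u t j : nat)%:Z - v t j 0).
      by rewrite subE utt'; ring.
    by apply: rpredB.
  have := dvdz_mulmx_col _ _ Q _ vv i; rewrite mulmxBr /v !mulKVmx // !mxE -mulrBr.
  have di0 : dd i != 0.
    by apply: contraNneq a0 => di0; move: (dvd_a i); rewrite di0 dvd0z.
  have qE := divzK (dvd_a i); set q := (a %/ dd i)%Z in qE *.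
  have q0 : q != 0 by apply: contraNneq a0 => q0; rewrite -qE q0 mul0r.
  have -> : (a %| q * ((t i : nat)%:Z - (t' i : nat)%:Z))%Z
      = (dd i %| (t i : nat)%:Z - (t' i : nat)%:Z)%Z by rewrite -qE dvdz_mul2l.
  rewrite -eqz_mod_dvd -(modz_abs _ (dd i)) -(modz_abs (t' i : nat)%:Z (dd i)).
  by rewrite !modz_small ?ltz_nat ?ltn_ord // => /eqP[].
rewrite detB; have <- : #|T| = (\prod_(i < n) `|dd i|)%N.
  by rewrite card_dep_ffun foldrE big_map big_enum /=; apply: eq_bigr => i _; rewrite card_ord.
rewrite -cardsT -(card_imset _ uinj); apply: subset_leq_card.
by apply/fintype.subsetP => _ /imsetP[t _ ->].
Qed.

(** * From kernels to independent subgroups *)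

Lemma dvdz_row_congr (n : nat) (a : int) (B : 'M[int]_n) (f g : 'I_n -> int) (i : 'I_n) :
  (forall j, (a %| f j - g j)%Z) ->
  (a %| \sum_j B i j * f j)%Z = (a %| \sum_j B i j * g j)%Z.
Proof.
move=> fg; rewrite -(subrK (\sum_j B i j * g j) (\sum_j B i j * f j)).
apply: rpredDl; rewrite -sumrB; apply: rpred_sum => j _.
by rewrite -mulrBr; apply/dvdz_mull.
Qed.

Lemma group_set_mod_kernel (n k : nat) (B : 'M[int]_n) : group_set (mod_kernel n k B).
Proof.
apply/group_setP; split=> [|u v].
  rewrite inE; apply/forallP => i; rewrite big1 ?dvdz0 // => j _.
  by rewrite ffunE mulr0.
rewrite !inE => /forallP uK /forallP vK; apply/forallP => i.
rewrite (dvdz_row_congr _ _ _ _ (fun j => (u j : nat)%:Z + (v j : nat)%:Z)) => [|j].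
  rewrite (eq_bigr (fun j => B i j * (u j : nat)%:Z + B i j * (v j : nat)%:Z)).
    by rewrite big_split rpredD.
  by move=> j _; rewrite mulrDr.
by rewrite ffunE -eqz_mod_dvd -PoszD -modz_nat modz_mod.
Qed.

Lemma fraction_graph_lift (k b : nat) (u v : 'I_k.+1) : (0 < b)%N ->
  (u == v) || fraction_graph k.+1 b u v ->
  exists z : int, (`|z| < b)%N /\ (k.+1%:Z %| z - ((v : nat)%:Z - (u : nat)%:Z))%Z.
Proof.
move=> b0 /orP[/eqP->|/andP[_]]; first by exists 0; rewrite subrr subr0 dvdz0.
rewrite /mod_dist; case: ex_minnP => d /asboolP[u' [v' [uu vv ->]]] _ db.
exists (v' - u'); split; first by rewrite distnC.
have -> : v' - u' - ((v : nat)%:Z - (u : nat)%:Z) = (v' - (v : nat)%:Z) - (u' - (u : nat)%:Z) by ring.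
by apply: rpredB; rewrite -eqz_mod_dvd; apply/eqP.
Qed.

(** If two elements of the kernel were adjacent, their difference would have
representatives w_j of absolute value less than b; this w is in the kernel too,
so it vanishes by the separation hypothesis. *)
Lemma alpha_grp_mod_kernel (n k b : nat) (B : 'M[int]_n) : (0 < b)%N ->
  (forall w : 'I_n -> int, (forall j, (`|w j| < b)%N) ->
     (forall i, (k.+1%:Z %| \sum_j B i j * w j)%Z) -> forall j, w j = 0) ->
  (#|mod_kernel n k B| <= alpha_grp (strong_pow (fraction_graph k.+1 b) n))%N.
Proof.
move=> b0 Bsep; pose G := Group (group_set_mod_kernel n k B).
suff ind : independent (strong_pow (fraction_graph k.+1 b) n) G.
  rewrite /alpha_grp.
  exact: (@leq_bigmax_cond _ (fun K : {group {dffun forall _ : 'I_n, 'I_k.+1}} =>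
    independent (strong_pow (fraction_graph k.+1 b) n) K) (fun K => #|K|) G ind).
apply/forallP => u; apply/implyP => uG; apply/forallP => v; apply/implyP => vG.
apply/negP => /andP[uv /forallP adj]; case/negP: uv; apply/eqP/ffunP => j; apply/val_inj => /=.
have [w wP] := fin_all_exists (fun i => fraction_graph_lift k b (u i) (v i) b0 (adj i)).
have w0 : w j = 0.
  apply: Bsep => [l|i]; first by case: (wP l).
  rewrite (dvdz_row_congr _ _ _ _ (fun j => (v j : nat)%:Z - (u j : nat)%:Z)) => [|l].
    move: uG vG; rewrite !inE => /forallP uG /forallP vG.
    rewrite (eq_bigr (fun j => B i j * (v j : nat)%:Z - B i j * (u j : nat)%:Z)).
      by rewrite sumrB rpredB.
    by move=> l _; rewrite mulrBr.
  by case: (wP l).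
have [_] := wP j; rewrite w0 sub0r opprB -eqz_mod_dvd.
by rewrite !modz_small ?ltz_nat ?ltn_ord // => /eqP[].
Qed.

Lemma Theta_grp_ge (R : realType) (gT : finGroupType) (e : rel gT) (n : nat) (y : R) :
  (0 < n)%N -> 0 <= y -> y ^+ n <= (alpha_grp (strong_pow e n))%:R -> y <= Theta_grp R e.
Proof.
move=> n0 y0 yle.
have rootE (z : R) (l : nat) : (0 < l)%N -> 0 <= z -> (z ^+ l) `^ (l%:R)^-1 = z.
  move=> l0 z0; rewrite -powR_mulrn // -powRrM mulfV ?powRr1 //.
  by rewrite pnatr_eq0 -lt0n.
apply: (@le_trans _ _ ((alpha_grp (strong_pow e n))%:R `^ (n%:R)^-1)).
  rewrite -{1}(rootE y n n0 y0); apply: ge0_ler_powR; rewrite ?nnegrE ?exprn_ge0 ?invr_ge0 //.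
rewrite /Theta_grp; apply: ub_le_sup; last by exists n.
exists (#|gT|%:R) => _ [l /= l0 <-].
rewrite -[leRHS](rootE _ l l0) //; apply: ge0_ler_powR; rewrite ?nnegrE ?exprn_ge0 ?invr_ge0 //.
rewrite -natrX ler_nat; apply/bigmax_leqP => G _.
by apply: leq_trans (max_card _) _; rewrite card_ffun card_ord.
Qed.

(** * The relation matrix separates *)

Lemma relation_mx_separates_ge0 (R : realFieldType) (m K N h : nat) (r : R)
    (y : 'I_(1 + m) -> R) (c : 'I_(1 + m) -> int) :
  (0 < m)%N -> (0 < K)%N -> N%:R + h%:R / K%:R + K%:R^-1 <= r ->
  (2 * K * (m * K ^ m) * (3 * m + 1) <= N)%N ->
  (forall j, `|y j| < 1) ->
  (forall i, \sum_j (relation_mx m K N h i j)%:~R * y j = r * (c i)%:~R) ->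
  0 <= c ord0 -> forall i, c i = 0.
Proof.
move=> m0 K0 xr Nbig y1 By c0.
pose Y (j : nat) := y (inord j).
pose s (i : nat) := \sum_(j < m.+1) (relation_row m K N h i j)%:~R * Y j.
pose e (i : nat) := \sum_(j < i.+1) defect R m K N h i j * Y j.
have yY (j : 'I_(1 + m)) : y j = Y j by rewrite /Y inord_val.
have By0 : \sum_(j < m.+1) (first_row K N j)%:~R * Y j = r * (c ord0)%:~R.
  by rewrite -By; apply: eq_bigr => j _; rewrite mxE -yY.
have Nbig' : 2 * K%:R * (m%:R * K%:R ^+ m) * (3 * m%:R + 1) <= N%:R :> R.
  by move: Nbig; rewrite -(ler_nat R) !(natrM, natrD, natrX).
have row0 : N%:R * Y 0%N + \sum_(j < m) K%:R ^+ j * Y j.+1 = r * (c ord0)%:~R.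
  rewrite -By0 big_ord_recl /=; congr (_ + _).
  by apply: eq_bigr => j _; rewrite -natrX.
have s0 : s 0%N = - (h%:R * (r * (c ord0)%:~R)).
  rewrite -By0 mulr_sumr -sumrN; apply: eq_bigr => j _.
  by rewrite relation_row0 rmorphN rmorphM /= -pmulrn mulNr mulrA.
have si i : (i < m)%N -> s i.+1 = r * (c (inord i.+1))%:~R.
  move=> im; rewrite -By; apply: eq_bigr => j _; rewrite mxE -yY.
  by rewrite (@inordK m) //=.
have rec i : (i < m)%N -> s i.+1 = s i / K%:R + (N%:R + h%:R / K%:R) * Y i.+1 + e i.
  exact: relation_row_recurrence.
have He i : (i < m)%N -> exists2 rho : R, - (2 * m%:R + 1) <= rho <= - (2 * m%:R)
     & `|e i - rho * Y 0%N| <= \sum_(j < i) `|Y j.+1|.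
  move=> im; exists (defect R m K N h i 0); first exact: defect_border.
  rewrite /e big_ord_recl /= addrC addKr; apply: le_trans (ler_norm_sum _ _ _) _.
  apply: ler_sum => j _; rewrite normrM -[leRHS]mul1r ler_wpM2r //.
  exact: defect_le.
have [c00 ci0] := @no_short_relation_ge0 R m K N%:R h%:R _ r Y e s (c ord0)
  (fun i => c (inord i.+1)) m0 K0 (ler0n _ _) (erefl _) xr Nbig'
  (fun j _ => y1 _) row0 s0 si rec He c0.
move=> i; have [i0|i0] := eqVneq (i : nat) 0%N.
  by have -> : i = ord0 by apply/val_inj.
have im : (i.-1 < m)%N by have := ltn_ord i; case: (i : nat) i0.
have := ci0 _ im; rewrite prednK ?lt0n //; by rewrite inord_val.
Qed.

Lemma relation_mx_separates (R : realFieldType) (m K N h : nat) (r : R)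
    (y : 'I_(1 + m) -> R) (c : 'I_(1 + m) -> int) :
  (0 < m)%N -> (0 < K)%N -> N%:R + h%:R / K%:R + K%:R^-1 <= r ->
  (2 * K * (m * K ^ m) * (3 * m + 1) <= N)%N ->
  (forall j, `|y j| < 1) ->
  (forall i, \sum_j (relation_mx m K N h i j)%:~R * y j = r * (c i)%:~R) ->
  forall i, c i = 0.
Proof.
move=> m0 K0 xr Nbig y1 By; have [c0|c0] := lerP 0 (c ord0).
  exact: relation_mx_separates_ge0 xr Nbig y1 By c0.
move=> i; apply: oppr_inj; rewrite oppr0.
apply: (@relation_mx_separates_ge0 R m K N h r (fun j => - y j) (fun j => - c j)) => //.
- by move=> j; rewrite normrN.
- move=> l; rewrite rmorphN mulrN -By -sumrN; apply: eq_bigr => j _; by rewrite mulrN.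
- by rewrite oppr_ge0 ltW.
Qed.

Lemma mulmx_det_neq0_inj (n : nat) (B : 'M[int]_n) (w : 'I_n -> int) :
  \det B != 0 -> (forall i, \sum_j B i j * w j = 0) -> forall j, w j = 0.
Proof.
move=> B0 Bw j; pose v : 'cV[int]_n := \col_j w j.
have Bv : B *m v = 0.
  by apply/matrixP => i k; rewrite !mxE -[RHS](Bw i); apply: eq_bigr => l _; rewrite mxE.
have := congr1 (mulmx (\adj B)) Bv; rewrite mulmxA mul_adj_mx mulmx0 mul_scalar_mx.
move/matrixP/(_ j 0); rewrite !mxE => /eqP; rewrite mulf_eq0 (negPf B0) /=.
by move/eqP.
Qed.

(** Apply [relation_mx_separates] to y = w/b and r = a/b: all B w / a vanish, and
B is invertible over the rationals. *)
Lemma relation_mx_kernel_separated (m K N h a b : nat) :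
  (0 < m)%N -> (0 < K)%N -> (0 < b)%N ->
  N%:R + h%:R / K%:R + K%:R^-1 <= a%:R / b%:R :> rat ->
  (2 * K * (m * K ^ m) * (3 * m + 1) <= N)%N ->
  \det (relation_mx m K N h) != 0 ->
  forall w : 'I_(1 + m) -> int, (forall j, (`|w j| < b)%N) ->
    (forall i, (a%:Z %| \sum_j relation_mx m K N h i j * w j)%Z) ->
    forall j, w j = 0.
Proof.
move=> m0 K0 b0 xr Nbig B0 w wb wa.
have b0' : 0 < b%:R :> rat by rewrite ltr0n.
have [c cP] := fin_all_exists (fun i => elimT dvdzP (wa i)).
have c0 : forall i, c i = 0.
  apply: (@relation_mx_separates rat m K N h _ (fun j => (w j)%:~R / b%:R) c m0 K0 xr Nbig).
    move=> j; rewrite normrM normfV [`|b%:R|]gtr0_norm // ltr_pdivrMr // mul1r.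
    by rewrite -intr_norm -[b%:R]/(b%:Z%:~R) ltr_int -abszE ltz_nat.
  move=> i; transitivity ((\sum_j relation_mx m K N h i j * w j)%:~R / b%:R : rat).
    rewrite rmorph_sum mulr_suml; apply: eq_bigr => j _; by rewrite rmorphM mulrA.
  by rewrite cP rmorphM /=; ring.
apply: mulmx_det_neq0_inj B0 _ => i; by rewrite cP c0 mul0r.
Qed.

(** * Choice of the parameters *)

(** With t = d/x this is (1 - t)^n <= 1/(1 + n t) <= 1 - 2/x: dividing the loss 2
in one factor by n spreads it evenly over the n factors. *)
Lemma power_root_estimate (R : realFieldType) (m : nat) (x d : R) :
  4 <= x -> 0 <= d <= x -> 4 <= m.+1%:R * d -> (x - d) ^+ m.+1 <= (x - 2) * x ^+ m.
Proof.
move=> x4 /andP[d0 dx] md.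
have bern n : (x - d) ^+ n * (x + n%:R * d) <= x ^+ n.+1.
  elim: n => [|n IH]; first by rewrite mul0r addr0 mul1r.
  rewrite exprSr [leRHS]exprSr -mulrA.
  apply: (@le_trans _ _ ((x - d) ^+ n * (x + n%:R * d) * x)).
    rewrite -mulrA; apply: ler_wpM2l; first by rewrite exprn_ge0 // subr_ge0.
    rewrite -natr1 -subr_ge0.
    have -> : (x + n%:R * d) * x - (x - d) * (x + (n%:R + 1) * d) = (n%:R + 1) * d ^+ 2 by ring.
    by rewrite mulr_ge0 ?sqr_ge0 ?addr_ge0.
  by rewrite ler_wpM2r //; lra.
set u := m.+1%:R * d in md.
have xu : 0 < x + u by lra.
rewrite -(ler_pM2r xu); apply: le_trans (bern _) _.
rewrite -/u 2!exprSr -mulrA -[leRHS]mulrA [leRHS]mulrCA.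
apply: ler_wpM2l; first by rewrite exprn_ge0 //; lra.
nra.
Qed.

(** Take N K + h = floor (K r) - 1: subtracting 1 keeps the fraction at distance
at least 1/K from r. *)
Lemma approx_below (r : rat) (K M : nat) : (0 < K)%N -> M.+2%:R <= r ->
  exists N h : nat, [/\ (M <= N)%N, (h < K)%N, N%:R + h%:R / K%:R + K%:R^-1 <= r
    & r <= N%:R + h%:R / K%:R + 2 / K%:R].
Proof.
move=> K0 Mr; have k0 : 0 < K%:R :> rat by rewrite ltr0n.
have k1 : 1 <= K%:R :> rat by rewrite ler1n.
pose t := Num.floor (K%:R * r).
have fl1 : t%:~R <= K%:R * r := floor_le_tmp _.
have fl2 : K%:R * r < (t + 1)%:~R := floorD1_gt _.
rewrite intrD in fl2.
have Kr : K%:R * M%:R + 2 <= K%:R * r.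
  rewrite -addn2 natrD in Mr; have := ler_wpM2l (ltW k0) Mr; lra.
have tge : (K * M)%:Z <= t - 1.
  rewrite -ltzD1 subrK -(ltr_int rat) -pmulrn natrM; lra.
have [e eE] : exists e : nat, t = e.+1%:Z.
  exists `|t - 1|%N; rewrite -addn1 PoszD abszE ger0_norm ?subrK //.
  exact: le_trans tge.
rewrite {}eE -addn1 PoszD addrK lez_nat in tge fl1 fl2.
rewrite -pmulrn natrD in fl1; rewrite rmorphD /= -pmulrn in fl2.
have eE : e%:R = (e %/ K)%N%:R * K%:R + (e %% K)%N%:R :> rat.
  by rewrite {1}(divn_eq e K) natrD natrM.
have xE : (e %/ K)%N%:R + (e %% K)%N%:R / K%:R = e%:R / K%:R :> rat.
  by rewrite eE; field; rewrite gt_eqF.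
exists (e %/ K)%N, (e %% K)%N; rewrite xE; split.
- by rewrite leq_divRL // mulnC.
- by rewrite ltn_pmod.
- by rewrite -[X in _ + X <= _]mul1r -mulrDl ler_pdivrMr // [r * _]mulrC; lra.
- by rewrite -mulrDl ler_pdivlMr // [r * _]mulrC; lra.
Qed.

Theorem theorem1p3 (R : realType) (eps : R) (eps_gt0 : 0 < eps) :
  exists C : R, forall r : rat, C <= ratr r ->
    exists a b : nat,
      [/\ (1 <= a)%N, (1 <= b)%N, a%:R / b%:R = r
        & ratr r - Theta_grp R (fraction_graph a b) < eps].
Proof.
(* Half of eps covers r - x <= 2/K, a quarter the n-th root of the determinant. *)
pose K := (Num.truncn (4 / eps)).+1; pose m := (Num.truncn (16 / eps)).+1.
pose M1 := (2 * K * (m * K ^ m) * (3 * m + 1))%N.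
pose M2 := ((m * K ^ m + 1) * (3 * m + 1))%N.
pose M3 := (Num.truncn eps).+1.
pose M := (M1 + M2 + M3 + 4)%N.
have Keps : 4 <= K%:R * eps by rewrite -ler_pdivrMr // ltW // truncnS_gt.
have meps : 16 <= m.+1%:R * eps.
  rewrite -ler_pdivrMr //; apply: (@le_trans _ _ m%:R); last by rewrite ler_nat.
  by rewrite ltW // truncnS_gt.
have Meps : eps <= M%:R.
  apply: (@le_trans _ _ M3%:R); first by rewrite ltW // truncnS_gt.
  by rewrite ler_nat /M -addnA addnC -addnA leq_addr.
exists M.+2%:R => r; rewrite -(ratr_nat R) ler_rat => Mr.
have K0 : (0 < K)%N by []. have m0 : (0 < m)%N by [].
have [N [h [MN hK xr rx]]] := approx_below r K M K0 Mr.
have Nsep : (M1 <= N)%N by apply: leq_trans MN; rewrite /M -!addnA leq_addr.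
have Ndet : (M2 <= N)%N by apply: leq_trans MN; rewrite /M -!addnA addnCA leq_addr.
have N4 : (4 <= N)%N by apply: leq_trans MN; rewrite /M leq_addl.
have k0 : 0 < K%:R :> R by rewrite ltr0n.
pose x : R := N%:R + h%:R / K%:R.
have Nx : N%:R <= x by rewrite lerDl divr_ge0.
have N4' : 4 <= N%:R :> R by rewrite ler_nat.
have MN' : M%:R <= N%:R :> R by rewrite ler_nat.
have detB := det_relation_mx_ge R m K N h K0 Ndet.
rewrite -/x in detB.
have x0 : 0 < x by lra.
have lb0 : 0 < (N%:R - 1) * x ^+ m by rewrite mulr_gt0 ?exprn_gt0 //; lra.
set D := \det (relation_mx m K N h) in detB.
have D0 : 0 < D by rewrite -(ltr_int R); apply: lt_le_trans detB.
have absD : `|D|%N%:Z = D by rewrite abszE gtr0_norm.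
have r0 : 0 < r by apply: lt_le_trans Mr.
have numr0 : 0 < numq r by rewrite numq_gt0.
(* The common factor D makes det B divide a, as the count of the kernel needs. *)
pose a := (`|numq r| * `|D|)%N; pose b := (`|denq r| * `|D|)%N.
have absD0 : (0 < `|D|)%N by rewrite absz_gt0 gt_eqF.
have a0 : (0 < a)%N by rewrite muln_gt0 absD0 absz_gt0 gt_eqF.
have b0 : (0 < b)%N by rewrite muln_gt0 absD0 absz_gt0 gt_eqF ?denq_gt0.
have abr : a%:R / b%:R = r :> rat.
  rewrite /a /b !natrM -mulf_div mulfV ?mulr1; last by rewrite pnatr_eq0 -lt0n.
  by rewrite !pmulrn !abszE !gtr0_norm ?denq_gt0 // divq_num_den.
exists a, b; split => //.
(* The kernel lives over moduli in successor form. *)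
case: {-2}a (erefl a) a0 => // k ak _.
have xr' : ratr r <= x + 2 / K%:R.
  have := rx; rewrite -(ler_rat R) !rmorphD /= !fmorph_div /= !ratr_nat; exact.
have K2 : 2 / K%:R <= eps / 2 by rewrite ler_pdivrMr //; lra.
suff : x - eps / 4 <= Theta_grp R (fraction_graph k.+1 b) by lra.
apply: (@Theta_grp_ge _ _ _ m.+1) => //; first lra.
have eps4 : 0 <= eps / 4 <= x by apply/andP; split; lra.
apply: le_trans (power_root_estimate _ m x (eps / 4) _ eps4 _) _; [lra | lra |].
have x2 : x - 2 <= N%:R - 1.
  have : h%:R / K%:R <= 1 :> R.
    by rewrite ler_pdivrMr // mul1r ler_nat ltnW.
  rewrite /x; lra.
apply: (@le_trans _ _ ((N%:R - 1) * x ^+ m)).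
  by apply: ler_wpM2r => //; rewrite exprn_ge0 // ltW.
apply: le_trans detB _; rewrite -absD -pmulrn ler_nat.
apply: leq_trans (alpha_grp_mod_kernel _ _ _ (relation_mx m K N h) b0 _).
  by apply: card_mod_kernel_ge; rewrite ?gt_eqF // ak dvdn_mull.
apply: relation_mx_kernel_separated => //; last by rewrite gt_eqF.
by rewrite ak abr.
Qed.
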